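(* If $q > p \geq 3$ are primes, then \[ \chi_a(\mathcal{U}(\mathbb{Z}_{pq})) \geq \frac{pq+1}{2}. \]
   Context: For a finite ring $R$ with unity and unit group $R^*$, the unitary addition Cayley graph $\mathcal{U}(R)$ is the simple graph with vertex set $R$ in which distinct vertices $x,y$ are adjacent if and only if $x+y \in R^*$; $\mathbb{Z}_n$ is the ring of integers modulo $n$. The achromatic number $\chi_a(G)$ of a graph $G$ is the maximum number of colors in a proper vertex coloring of $G$ such that for every pair of distinct color classes there is at least one edge of $G$ joining a vertex of one class to a vertex of the other. *)

(* Defs.v *)
From mathcomp Require Import all_boot all_order all_algebra.

Set Implicit Arguments.
Unset Strict Implicit.
Unset Printing Implicit Defensive.

Import GRing.Theory.
Local Open Scope ring_scope.

Record sgraph := SGraph {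
  vertex :> finType;
  adj : rel vertex;
  adj_sym : symmetric adj;
  adj_irrefl : irreflexive adj
}.

Section Coloring.
Variables (G : sgraph) (k : nat).
Implicit Type c : {ffun G -> 'I_k}.

Definition proper_coloring c : bool :=
  [forall x, forall y, adj x y ==> (c x != c y)].

(* Color classes are nonempty, so each of the k colors has to be used. *)
Definition all_colors_used c : bool := [forall i, exists x, c x == i].

Definition classes_joined c : bool :=
  [forall i, forall j, (i != j) ==>
    [exists x, exists y, [&& c x == i, c y == j & adj x y]]].

Definition complete_coloring c : bool :=
  [&& proper_coloring c, all_colors_used c & classes_joined c].

End Coloring.

(* The bound k <= #|G| loses nothing: see leq_achromatic_number. *)
Definition achromatic_number (G : sgraph) : nat :=
  (\max_(k < #|G|.+1 | [exists c : {ffun G -> 'I_k}, complete_coloring c]) k)%N.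

Lemma leq_achromatic_number (G : sgraph) (k : nat) (c : {ffun G -> 'I_k}) :
  complete_coloring c -> (k <= achromatic_number G)%N.
Proof.
move=> cc; have lek : (k < #|G|.+1)%N.
  case/and3P: cc => _ /forallP used _; rewrite ltnS -[k]card_ord.
  have /subset_leq_card : 'I_k \subset codom c.
    apply/subsetP=> i _; have /existsP[x /eqP <-] := used i.
    exact: codom_f.
  by move/leq_trans; apply; rewrite (leq_trans (card_size _)) // size_codom.
apply: (@leq_bigmax_cond _ _ (fun i : 'I_#|G|.+1 => i : nat) (Ordinal lek)).
by apply/existsP; exists c.
Qed.

Section UnitaryAdditionCayley.
Variable R : finUnitRingType.

Definition uac_adj : rel R :=
  [rel x y | (x != y) && (x + y \is a GRing.unit)].

Lemma uac_adj_sym : symmetric uac_adj.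
Proof. by move=> x y; rewrite /uac_adj /= eq_sym addrC. Qed.

Lemma uac_adj_irrefl : irreflexive uac_adj.
Proof. by move=> x; rewrite /uac_adj /= eqxx. Qed.

Definition unitary_addition_cayley : sgraph := SGraph uac_adj_sym uac_adj_irrefl.

End UnitaryAdditionCayley.

(* Main.v *)
(** It is enough to find an involution [s] of the vertices such that [x] and
    [s x] are never adjacent while any two distinct orbits are joined: the orbits
    are then the classes of a complete coloring, and there are at least
    [#|G| / 2] of them.
    By the Chinese remainder theorem, two vertices of [U(Z_pq)], seen as distinct
    pairs [(a, b)], [(c, d)] in [Z_p x Z_q], are adjacent iff [a + c] and [b + d]
    are nonzero.  Away from the columns [a = 0, 1, -1], pairing [(a, b)] with
    [(-a, b + 1)] or [(-a, b - 1)], according to the sign of [a], works.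
    The column [a = 0] is an independent set, so its points [(0, b)] are paired
    with [(1, -b)] for [b > 0] and with [(-1, -b)] for [b < 0]; the remaining
    points of the columns [1] and [-1] are paired with each other, and [(0, 0)]
    is fixed. *)
Require Import Defs.
From mathcomp Require Import all_boot all_order all_algebra.
From mathcomp Require Import zify.

Import Order.TTheory GRing.Theory Num.Theory.
Local Open Scope ring_scope.

Lemma card_le_double_achromatic (G : sgraph) (s : G -> G) :
    involutive s -> (forall x, ~~ adj x (s x)) ->
    (forall x y, y != x -> y != s x ->
      [|| adj x y, adj x (s y), adj (s x) y | adj (s x) (s y)]) ->
  (#|G| <= 2 * achromatic_number G)%N.
Proof.
move=> sK s_nadj s_join.
(* The empty graph is set aside because [enum_rank_in] needs a default orbit. *)
case: (pickP (predT : pred G)) => [x0 _ | G0]; last by rewrite eq_card0.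
pose orb x := [set x; s x]; pose orbits := [set orb x | x : G].
have orbP x : orb x \in orbits by apply: imset_f.
have orb_s x : orb (s x) = orb x by rewrite /orb sK setUC.
have orb_eq x y : orb x = orb y -> y = x \/ y = s x.
  by move=> e; have := set21 y (s y); rewrite -/(orb y) -e => /set2P.
pose c := [ffun x => enum_rank_in (orbP x0) (orb x)].
have c_eq x y : c x = c y -> orb x = orb y.
  by rewrite !ffunE => /(enum_rank_in_inj (orbP x) (orbP y)).
have c_s x : c (s x) = c x by rewrite !ffunE orb_s.
have c_onto i : exists x, c x == i.
  have /imsetP[x _ ex] := enum_valP i.
  by exists x; rewrite ffunE -ex enum_valK_in.
have c_complete : complete_coloring c.
  apply/and3P; split.
  - apply/forallP=> x; apply/forallP=> y; apply/implyP=> xy.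
    apply/negP=> /eqP /c_eq /orb_eq [] ey; move: xy; rewrite ey.
      by rewrite adj_irrefl.
    by rewrite (negbTE (s_nadj x)).
  - by apply/forallP=> i; apply/existsP.
  - apply/forallP=> i; apply/forallP=> j; apply/implyP=> ij.
    have [x /eqP cx] := c_onto i; have [y /eqP cy] := c_onto j.
    have yx : y != x by apply: contraNneq ij => e; rewrite -cx -cy e.
    have ysx : y != s x by apply: contraNneq ij => e; rewrite -cx -cy e c_s.
    have joined u v : c u = i -> c v = j -> adj u v ->
      [exists x, exists y, [&& c x == i, c y == j & adj x y]].
      move=> cu cv uv; apply/existsP; exists u; apply/existsP; exists v.
      by rewrite cu cv !eqxx.
    by case/or4P: (s_join x y yx ysx) => /joined; apply; rewrite ?c_s.
have cover_orbits : cover orbits = setT.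
  apply/setP=> x; rewrite inE; apply/bigcupP.
  by exists (orb x); rewrite ?orbP // set21.
have le_orb := leq_achromatic_number c_complete.
apply: (@leq_trans (2 * #|orbits|)%N); last by rewrite leq_pmul2l.
rewrite -cardsT -cover_orbits (leq_trans (leq_card_cover _)) //.
rewrite mulnC -sum_nat_const leq_sum // => A /imsetP[x _ ->].
by rewrite cards2; case: (_ != _).
Qed.

Section Mate.
Variables n m : int.
Hypotheses (n_gt0 : 0 < n) (m_gt0 : 0 < m).

(** For n = (p - 1)/2 and m = (q - 1)/2 these are the symmetric representatives of Z_p x Z_q. There
    a sum of two coordinates vanishes modulo p or q only if it vanishes in [int], so only linear
    arithmetic remains. *)
Definition box (x : int * int) : bool :=
  [&& - n <= x.1, x.1 <= n, - m <= x.2 & x.2 <= m].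

(* In the columns 1 and -1 the shift by [m] avoids the pair {(1, 0), (-1, 0)},
   which would not be joined to (0, 0). *)
Definition mate (x : int * int) : int * int :=
  let: (a, b) := x in
  if a == 0 then (if b == 0 then 0 else if 0 < b then 1 else -1, - b)
  else if a == 1 then (if 0 <= b then (-1, b - m) else (0, - b))
  else if a == -1 then (if b <= 0 then (1, b + m) else (0, - b))
  else if 0 < a then (- a, if b == m then - m else b + 1)
  else (- a, if b == - m then m else b - 1).

Definition box_adj (x y : int * int) : bool :=
  [&& x != y, x.1 + y.1 != 0 & x.2 + y.2 != 0].

Lemma mate_box x : box x -> box (mate x).
Proof.
by case: x => a b; rewrite /box /mate /=; repeat case: ifP => ?; move=> /=; lia.
Qed.

Lemma mateK x : box x -> mate (mate x) = x.
Proof.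
case: x => a b; rewrite /box [mate (a, b)]/mate /= => bx.
by repeat case: ifP => ?; rewrite /mate; repeat (case: ifP => ?);
  by [lia | congr pair; lia].
Qed.

(** Mates have opposite first coordinates, or opposite second ones if one of them lies in the column
    0. *)
Lemma mate_nadj x : box x -> ~~ box_adj x (mate x).
Proof.
case: x => a b; rewrite /box /box_adj /mate /= => bx.
by repeat case: ifP => ?; rewrite /= xpair_eqE; lia.
Qed.

(** Off the columns 0, 1, -1, take from each orbit the point with positive first coordinate. If
    their second coordinates cancel, replace one point by its mate (distinct columns) or both (same
    column): that sum moves by 1 or 2 modulo 2m + 1 >= 3, and the first coordinates still do not
    cancel. Orbits meeting the three columns are a finite case check. *)
Lemma mate_join x y : box x -> box y -> y != x -> y != mate x ->
  [|| box_adj x y, box_adj x (mate y), box_adj (mate x) y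
    | box_adj (mate x) (mate y)].
Proof.
case: x y => [a b] [c d]; rewrite /box /box_adj /mate /= => bx by_.
by repeat case: ifP => ?; rewrite /= !xpair_eqE /=; lia.
Qed.

End Mate.

Section SymmetricResidue.
Variable p : nat.
Hypothesis p_odd : odd p.

Definition sres (x : nat) : int :=
  if (x %% p <= p./2)%N then (x %% p)%:Z else (x %% p)%:Z - p%:Z.

Definition ures (a : int) : nat :=
  if 0 <= a then `|a|%N else (p - `|a|)%N.

Let p_gt0 : (0 < p)%N. Proof. exact: odd_gt0. Qed.
Let p_half : p = (p./2 + p./2).+1%N.
Proof. by rewrite -[LHS]odd_double_half p_odd addnn. Qed.

Lemma sres_bound x : - (p./2)%:Z <= sres x <= (p./2)%:Z.
Proof.
rewrite /sres; have := ltn_pmod x p_gt0; have := p_half.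
by case: ifP => *; lia.
Qed.

Lemma sresK x : ures (sres x) = (x %% p)%N.
Proof.
rewrite /sres; have := ltn_pmod x p_gt0; have := p_half.
by move: (x %% p)%N => u; case: ifP => ? ? ? //; rewrite /ures; case: ifP => ?; lia.
Qed.

Lemma uresK a : - (p./2)%:Z <= a <= (p./2)%:Z -> sres (ures a) = a.
Proof.
move=> ba; have ph := p_half; rewrite /sres.
have -> : (ures a %% p = ures a)%N.
  by rewrite modn_small // /ures; case: ifP => *; lia.
by rewrite /ures; case: (boolP (0 <= a)) => ?; case: ifP => ?; lia.
Qed.

Lemma sres_modn x : sres (x %% p) = sres x.
Proof. by rewrite /sres modn_mod. Qed.

(** Two symmetric residues add up to at most p - 1 in absolute value, and 0 is the only multiple of
    p in that range. *)
Lemma dvdn_add_sres x y : (p %| x + y)%N = (sres x + sres y == 0).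
Proof.
rewrite /dvdn -modnDm /sres; have := p_half.
have := ltn_pmod x p_gt0; have := ltn_pmod y p_gt0.
move: (x %% p)%N (y %% p)%N => u v vp up ph.
have -> : ((u + v) %% p == 0)%N = ((u + v == 0) || (u + v == p))%N.
  have [uvp|puv] := ltnP (u + v) p; first by rewrite modn_small //; lia.
  by rewrite -(subnK puv) modnDr modn_small; lia.
by case: ifP => ?; case: ifP => *; lia.
Qed.

End SymmetricResidue.

Section Crt.
Variables p q : nat.
Hypotheses (p_odd : odd p) (q_odd : odd q).
Hypotheses (pr_p : prime p) (pr_q : prime q) (neq_pq : p != q).

Let pq_gt1 : (1 < p * q)%N.
Proof. by have := prime_gt1 pr_p; have := prime_gt1 pr_q; nia. Qed.

Let co_pq : coprime p q.
Proof. by rewrite prime_coprime // dvdn_prime2. Qed.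

Definition coords (x : 'Z_(p * q)) : int * int := (sres p x, sres q x).

Definition point (a : int * int) : 'Z_(p * q) :=
  (chinese p q (ures p a.1) (ures q a.2))%:R.

Lemma coords_box x : box (p./2)%:Z (q./2)%:Z (coords x).
Proof. by rewrite /box andbA !sres_bound. Qed.

Lemma pointK a : box (p./2)%:Z (q./2)%:Z a -> coords (point a) = a.
Proof.
case: a => a b; rewrite /box /= andbA => /andP[ba bb].
rewrite /coords /point /= !val_Zp_nat //.
rewrite -(sres_modn p) modn_dvdm ?dvdn_mulr // chinese_modl // sres_modn uresK //.
by rewrite -(sres_modn q) modn_dvdm ?dvdn_mull // chinese_modr // sres_modn uresK.
Qed.

Lemma coordsK x : point (coords x) = x.
Proof.
apply/val_inj; rewrite /point /= val_Zp_nat // !sresK //.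
(* The modulus built into ['Z_(p * q)] is p * q only because p * q > 1. *)
by rewrite -chinese_mod // modn_small // -[ltnRHS](Zp_cast pq_gt1).
Qed.

(** A residue modulo pq is a unit iff neither p nor q divides it; for a sum, [dvdn_add_sres] reads
    this off the coordinates. *)
Lemma uac_adj_coords (x y : 'Z_(p * q)) :
  @adj (unitary_addition_cayley 'Z_(p * q)) x y = box_adj (coords x) (coords y).
Proof.
rewrite /= /uac_adj /box_adj /= (inj_eq (can_inj coordsK)); congr andb.
rewrite -[x]natr_Zp -[y]natr_Zp -natrD unitZpE // coprimeMl.
by rewrite !prime_coprime // !dvdn_add_sres // !natr_Zp.
Qed.

End Crt.

Theorem theorem2 (p q : nat) (pr_p : prime p) (pr_q : prime q)
    (p_ge3 : (3 <= p)%N) (lt_pq : (p < q)%N) :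
  ((p * q + 1)%:R / 2 : rat)
    <= (achromatic_number (unitary_addition_cayley 'Z_(p * q)))%:R.
Proof.
have p_odd : odd p by case: (even_prime pr_p) p_ge3 => // ->.
have q_ge3 := leq_trans p_ge3 (ltnW lt_pq).
have q_odd : odd q by case: (even_prime pr_q) q_ge3 => // ->.
have neq_pq : p != q by rewrite neq_ltn lt_pq.
have n_gt0 : 0 < (p./2)%:Z by rewrite ltz_nat half_gt0 ltnW.
have m_gt0 : 0 < (q./2)%:Z by rewrite ltz_nat half_gt0 ltnW.
pose n := (p./2)%:Z; pose m := (q./2)%:Z.
have coordsK_pq := coordsK p q p_odd q_odd pr_p pr_q neq_pq.
have cbox x : box n m (coords p q x) by apply: coords_box.
pose s (x : 'Z_(p * q)) : 'Z_(p * q) := point p q (mate m (coords p q x)).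
have coords_s x : coords p q (s x) = mate m (coords p q x).
  by rewrite pointK // (mate_box n).
have sE x y : (y == s x) = (coords p q y == mate m (coords p q x)).
  by rewrite -coords_s (inj_eq (can_inj coordsK_pq)).
have le_card : (#|'Z_(p * q)| <=
    2 * achromatic_number (unitary_addition_cayley 'Z_(p * q)))%N.
  apply: (@card_le_double_achromatic (unitary_addition_cayley _) s).
  - by move=> x; apply/eqP; rewrite eq_sym sE coords_s (mateK n).
  - by move=> x; rewrite uac_adj_coords // coords_s (mate_nadj n).
  - move=> x y yx; rewrite sE => ysx; rewrite !uac_adj_coords // !coords_s.
    apply: (mate_join n m) => //.
    by rewrite (inj_eq (can_inj coordsK_pq)).
(* Parity gives the extra 1: an odd number bounded by an even one is strictly smaller. *)
have pq_odd : odd (p * q) by rewrite oddM p_odd.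
rewrite ler_pdivrMr // -natrM ler_nat.
move: le_card; rewrite card_ord Zp_cast; last by nia.
by move: (achromatic_number _) pq_odd => k; move: (p * q)%N => N; lia.
Qed.
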